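(* Let $A$ be an integral domain whose fraction field $\mathcal{K}(A)$ is formally real, and let $\alpha\in\operatorname{Spec}_rA$. The following properties are equivalent: (1) $\alpha\in\operatorname{Spec}_{pc}A$. (2) For any $f\in A$ such that $\alpha\in\mathcal{S}(f)$, the cone $\sum\mathcal{K}(A)^2[f]$ is proper. (3) For any $f\in A$ such that $\alpha\in\mathcal{S}(f)$, the cone $A\cap\sum\mathcal{K}(A)^2[f]$ of $A$ is proper and central. (4) For any $f\in A$ such that $\alpha\in\mathcal{S}(f)$, the intersection $\mathcal{S}(f)\cap\operatorname{Spec}_cA$ is non-empty.
   Context: All rings are commutative and contain $\mathbb{Q}$. A field is formally real if $-1$ is not a sum of squares. $\sum\mathcal{K}(A)^2$ is the set of sums of squares of elements of $\mathcal{K}(A)$. A cone of a ring $B$ is a subset $P\subset B$ with $P+P\subset P$, $P\cdot P\subset P$ and $b^2\in P$ for all $b\in B$; it is proper if $-1\notin P$. If $P$ is a cone of $B$ and $f\in B$, $P[f]$ denotes the smallest cone of $B$ containing $P$ and $f$; $\sum\mathcal{K}(A)^2[f]$ is a cone of $\mathcal{K}(A)$, and $A\cap\sum\mathcal{K}(A)^2[f]$ is the intersection of $A$ with this cone. A cone of $A$ is central if it contains $A\cap\sum\mathcal{K}(A)^2$. An ordering of $B$ is a proper cone $P$ such that $ab\in P$ implies $a\in P$ or $-b\in P$; $\operatorname{Spec}_rB$ is the set of orderings of $B$. For $\alpha\in\operatorname{Spec}_rA$, write $P_\alpha$ for the corresponding cone and $\operatorname{supp}(\alpha)=P_\alpha\cap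 -P_\alpha$; $a(\alpha)>0$ means $a\in P_\alpha\setminus\operatorname{supp}(\alpha)$. The sets $\mathcal{S}(f_1,\ldots,f_k)=\{\alpha\in\operatorname{Spec}_rA\mid f_1(\alpha)>0,\ldots,f_k(\alpha)>0\}$ generate the topology of $\operatorname{Spec}_rA$. The map $Q\mapsto Q\cap A$ identifies $\operatorname{Spec}_r\mathcal{K}(A)$ with the set of orderings of $A$ with support $(0)$; $\operatorname{Spec}_cA:=\overline{\operatorname{Spec}_r\mathcal{K}(A)}$ (closure in $\operatorname{Spec}_rA$). An ordering is precentral if it is a central cone; $\operatorname{Spec}_{pc}A$ is the set of precentral orderings. *)

(* Defs.v *)
From HB Require Import structures.
From mathcomp Require Import all_boot all_order all_algebra.
From mathcomp Require Import boolp classical_sets functions topology.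

Set Implicit Arguments.
Unset Strict Implicit.
Unset Printing Implicit Defensive.

Import GRing.Theory.

Local Open Scope classical_set_scope.
Local Open Scope ring_scope.

Definition sums_of_squares (B : comNzRingType) : set B :=
  [set b | exists s : seq B, b = \sum_(x <- s) x ^+ 2].
Arguments sums_of_squares : clear implicits.

Definition formally_real (F : fieldType) : Prop :=
  ~ sums_of_squares F (-1).

Record is_cone (B : comNzRingType) (P : set B) : Prop := IsCone {
  coneD : forall a b, P a -> P b -> P (a + b);
  coneM : forall a b, P a -> P b -> P (a * b);
  cone_sqr : forall b, P (b ^+ 2)
}.

Definition is_proper_cone (B : comNzRingType) (P : set B) : Prop :=
  is_cone P /\ ~ P (-1).

(* P[f] *)
Definition cone_adjoin (B : comNzRingType) (P : set B) (f : B) : set B :=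
  smallest (@is_cone B) (P `|` [set f]).

Record is_ordering (B : comNzRingType) (P : set B) : Prop := IsOrdering {
  ordering_proper : is_proper_cone P;
  ordering_prime : forall a b, P (a * b) -> P a \/ P (- b)
}.

(* Spec_r B; the coercion [ordering_cone] is alpha |-> P_alpha. *)
Record real_spec (B : comNzRingType) : Type := RealSpec {
  ordering_cone :> set B;
  ordering_coneP : is_ordering ordering_cone
}.

Definition supp (B : comNzRingType) (alpha : real_spec B) : set B :=
  [set b | ordering_cone alpha b /\ ordering_cone alpha (- b)].

(* b(alpha) > 0 *)
Definition positive_at (B : comNzRingType) (b : B) (alpha : real_spec B) : Prop :=
  (ordering_cone alpha `\` supp alpha) b.

(* S(f_1, ..., f_k) *)
Definition basic_open (B : comNzRingType) (fs : seq B) : set (real_spec B) :=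
  [set alpha | forall f, f \in fs -> positive_at f alpha].

HB.instance Definition _ (B : comNzRingType) := gen_eqMixin (real_spec B).
HB.instance Definition _ (B : comNzRingType) := gen_choiceMixin (real_spec B).
HB.instance Definition _ (B : comNzRingType) :=
  @isSubBaseTopological.Build (real_spec B) (set (real_spec B))
    (range (@basic_open B)) id.

Section Domain.
Variable A : idomainType.

(* A \cap T for T a subset of the fraction field K(A) *)
Definition trace_on (T : set {fraction A}) : set A :=
  @FracField.tofrac A @^-1` T.

Lemma trace_ordering (Q : real_spec {fraction A}) : is_ordering (trace_on Q).
Proof.
case: Q => Q [[[QD QM Qsq] QN1] Qp] /=; split.
  split; last by rewrite /trace_on /= rmorphN rmorph1.
  split=> [a b|a b|b]; rewrite /trace_on /= ?rmorphD ?rmorphM ?rmorphXn /=.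
  - exact: QD.
  - exact: QM.
  - exact: Qsq.
by move=> a b; rewrite /trace_on /= rmorphM rmorphN; exact: Qp.
Qed.

(* Q |-> Q \cap A, from Spec_r K(A) to Spec_r A *)
Definition restrict_ordering (Q : real_spec {fraction A}) : real_spec A :=
  RealSpec (trace_ordering Q).

(* Spec_c A *)
Definition central_spec : set (real_spec A) :=
  closure (range restrict_ordering).

Definition is_central_cone (P : set A) : Prop :=
  is_cone P /\ trace_on (sums_of_squares {fraction A}) `<=` P.

(* Spec_pc A *)
Definition precentral_spec : set (real_spec A) :=
  [set alpha : real_spec A | is_central_cone alpha].

(* \sum K(A)^2[f], for f in A *)
Definition sumsq_adjoin (f : A) : set {fraction A} :=
  cone_adjoin (sums_of_squares {fraction A}) (FracField.tofrac f).

End Domain.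

Arguments central_spec A : clear implicits.
Arguments precentral_spec A : clear implicits.

(* Main.v *)
Require Import Defs.
From HB Require Import structures.
From mathcomp Require Import all_boot all_order all_algebra.
From mathcomp Require Import boolp classical_sets functions topology.
From mathcomp Require filter.
From mathcomp Require Import ring.

Import GRing.Theory.
Local Open Scope classical_set_scope.
Local Open Scope ring_scope.

(** Everything rests on two facts about a proper cone [P] of a field [F].

    Adjunction: if [- f] is not in [P], then [P[f]] is proper.  Indeed the
    elements of [P[f]] are the [s + t * f] with [s, t] in [P]; an equality
    [-1 = s + t * f] forces [t != 0], and then [- f = (1 + s) / t] lies in [P],
    because [t^-1 = t * (t^-1) ^+ 2] does ([proper_cone_adjoin]).

    Extension: [P] is contained in an ordering of [F].  By Zorn's lemma [P] is
    contained in a maximal proper cone [M]; adjunction shows that [M] contains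
    [- a] whenever it does not contain [a], and such a cone of a field is an
    ordering ([proper_cone_sub_ordering]).

    Since an ordering [alpha] contains [a] or [- a] for each [a], the condition
    [alpha \in S(f)] just says that [- f] is not in [alpha]
    ([basic_open1P]).  So if [alpha] contains the elements of [A] that are sums
    of squares in [K(A)], then [- f] is not such a sum of squares, and
    adjunction gives (1) => (2).  The implication (2) => (3) restricts
    [\sum K(A)^2[f]] to [A].  For (3) => (4), an ordering of [K(A)] extending
    [\sum K(A)^2[f]] makes the nonzero element [f] positive.  For (4) => (1),
    let [a] in [A] be a sum of squares in [K(A)] that is not in [alpha]: then
    [alpha] is in the open set [S(- a)], which therefore meets the closure
    [Spec_c A] of [Spec_r K(A)], hence meets [Spec_r K(A)] itself, although no
    ordering of [K(A)] makes the sum of squares [a] negative. *)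

(** * Cones of a commutative ring *)

Section Cones.
Variable B : comNzRingType.
Implicit Types (P : set B) (f b : B).

Lemma cone0 P : is_cone P -> P 0.
Proof. by case=> _ _ /(_ 0); rewrite expr0n. Qed.

Lemma cone1 P : is_cone P -> P 1.
Proof. by case=> _ _ /(_ 1); rewrite expr1n. Qed.

Lemma sums_of_squares_sub P : is_cone P -> sums_of_squares B `<=` P.
Proof.
move=> Pcone _ [s ->]; apply: (big_ind P) => [||x _].
- exact: cone0.
- exact: coneD.
- exact: cone_sqr.
Qed.

Lemma sums_of_squares_cone : is_cone (sums_of_squares B).
Proof.
split=> [_ _ [s ->] [t ->]|_ _ [s ->] [t ->]|b].
- by exists (s ++ t); rewrite big_cat.
- exists [seq x * y | x <- s, y <- t]; rewrite big_allpairs_dep big_distrlr /=.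
  by apply: eq_bigr => x _; apply: eq_bigr => y _; rewrite exprMn.
- by exists [:: b]; rewrite big_seq1.
Qed.

Lemma cone_adjoin_cone P f : is_cone (cone_adjoin P f).
Proof.
split=> [a b Pa Pb|a b Pa Pb|b] Q [Qcone PfQ].
- by apply: coneD => //; [apply: Pa|apply: Pb].
- by apply: coneM => //; [apply: Pa|apply: Pb].
- exact: cone_sqr.
Qed.

Lemma sub_cone_adjoin P f : P `<=` cone_adjoin P f.
Proof. by move=> b Pb; apply: sub_gen_smallest; left. Qed.

Lemma mem_cone_adjoin P f : cone_adjoin P f f.
Proof. by apply: sub_gen_smallest; right. Qed.

(** Higher powers of [f] are absorbed by the coefficients: [f ^+ 2] is a square,
    so it already belongs to the cone. *)
Lemma cone_adjoinP P f b : is_cone P ->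
  cone_adjoin P f b -> exists s t, [/\ P s, P t & b = s + t * f].
Proof.
move=> Pcone; move: b; apply: smallest_sub.
  split.
  - move=> _ _ [s [t [Ps Pt ->]]] [s' [t' [Ps' Pt' ->]]].
    by exists (s + s'), (t + t'); split; [exact: coneD|exact: coneD|ring].
  - move=> _ _ [s [t [Ps Pt ->]]] [s' [t' [Ps' Pt' ->]]].
    exists (s * s' + t * t' * f ^+ 2), (s * t' + t * s').
    have sqf := cone_sqr Pcone f.
    split; last by ring.
      by apply: coneD => //; repeat apply: coneM => //.
    by apply: coneD => //; apply: coneM.
  - move=> b; exists (b ^+ 2), 0; rewrite mul0r addr0.
    by split=> //; [exact: cone_sqr|exact: cone0].
move=> b [Pb|->].
  by exists b, 0; rewrite mul0r addr0; split=> //; exact: cone0.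
by exists 0, 1; rewrite mul1r add0r; split=> //; [exact: cone0|exact: cone1].
Qed.

(** The set [P] is put into the union so that the statement also holds for the
    empty chain. *)
Lemma bigcup_chain_proper_cone P (C : set (set B)) :
    is_proper_cone P -> (forall X, C X -> is_proper_cone (X `|` P)) ->
    total_on C subset ->
  is_proper_cone ((\bigcup_(X in C) X) `|` P).
Proof.
move=> [Pcone PN1] Cproper Ctot.
pose U := (\bigcup_(X in C) X) `|` P.
have common a b : U a -> U b ->
    exists Q, [/\ is_cone Q, Q `<=` U, Q a & Q b].
  have inC X : C X -> is_cone (X `|` P) /\ X `|` P `<=` U.
    move=> CX; split; first by case: (Cproper X CX).
    by move=> x [Xx|Px]; [left; exists X|right].
  move=> [[X CX Xa]|Pa] [[Y CY Yb]|Pb].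
  - have [XY|YX] := Ctot _ _ CX CY.
      exists (Y `|` P); have [? ?] := inC Y CY; split=> //; left => //.
      exact: XY.
    exists (X `|` P); have [? ?] := inC X CX; split=> //; left => //.
    exact: YX.
  - by exists (X `|` P); have [? ?] := inC X CX; split=> //; [left|right].
  - by exists (Y `|` P); have [? ?] := inC Y CY; split=> //; [right|left].
  - by exists P; split=> // x Px; right.
split; last first.
  by case=> [[X CX XN1]|//]; case: (Cproper X CX) => _; apply; left.
split=> [a b Ua Ub|a b Ua Ub|b].
- by have [Q [Qcone QU Qa Qb]] := common a b Ua Ub; apply: QU; exact: coneD.
- by have [Q [Qcone QU Qa Qb]] := common a b Ua Ub; apply: QU; exact: coneM.
- by right; exact: cone_sqr.
Qed.

End Cones.

(** * Proper cones of a field *)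

Section FieldCones.
Variable F : fieldType.
Implicit Types (P : set F) (f b : F).

Lemma cone_inv P b : is_cone P -> P b -> P b^-1.
Proof.
move=> Pcone Pb; have [->|b0] := eqVneq b 0.
  by rewrite invr0; exact: cone0.
have -> : b^-1 = b * b^-1 ^+ 2 by field.
by apply: coneM => //; exact: cone_sqr.
Qed.

Lemma proper_cone_supp0 P f : is_proper_cone P -> P f -> P (- f) -> f = 0.
Proof.
move=> [Pcone PN1] Pf PNf; apply/eqP/negP => /negP f0; apply: PN1.
have -> : -1 = - f * f^-1 by field.
by apply: coneM => //; exact: cone_inv.
Qed.

Lemma proper_cone_adjoin P f : is_proper_cone P -> ~ P (- f) ->
  is_proper_cone (cone_adjoin P f).
Proof.
move=> [Pcone PN1] PNf; split; first exact: cone_adjoin_cone.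
move=> /(cone_adjoinP _ _ _ _ Pcone) [s [t [Ps Pt E]]].
have [t0|t0] := eqVneq t 0.
  by apply: PN1; rewrite E t0 mul0r addr0.
apply: PNf; have -> : - f = (1 + s) * t^-1.
  apply: (mulIf t0); rewrite mulfVK // mulNr mulrC.
  by rewrite -[X in X + s]opprK E; ring.
apply: coneM => //; last exact: cone_inv.
by apply: coneD => //; exact: cone1.
Qed.

Lemma total_proper_cone_ordering P : is_proper_cone P ->
  (forall a, P a \/ P (- a)) -> is_ordering P.
Proof.
move=> Pproper Ptot; split=> // a b Pab; have [Pcone _] := Pproper.
have [|PNa] := Ptot a; first by left.
have [->|a0] := eqVneq a 0; first by left; exact: cone0.
right; have -> : - b = - a * (a * b) * a^-1 ^+ 2 by field.
by apply: coneM => //; [exact: coneM|exact: cone_sqr].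
Qed.

Lemma proper_cone_sub_ordering P : is_proper_cone P ->
  exists Q : real_spec F, P `<=` Q.
Proof.
move=> Pproper.
have [|X [Xproper Xmax]] :=
    @Zorn_bigcup F [set X | is_proper_cone (X `|` P)].
  move=> C CP Ctot; exact: bigcup_chain_proper_cone.
pose M := X `|` P; have {}Xproper : is_proper_cone M by [].
have Mtot a : M a \/ M (- a).
  have [MNa|MNa] := pselect (M (- a)); [by right|left].
  have MaP : cone_adjoin M a `|` P = cone_adjoin M a.
    by apply/setUidPl => b Pb; apply: sub_cone_adjoin; right.
  apply: contrapT => Ma; apply: (Xmax (cone_adjoin M a)).
    split=> [b Xb|adjX]; first by apply: sub_cone_adjoin; left.
    by apply: Ma; left; apply: adjX; exact: mem_cone_adjoin.
  by rewrite /= MaP; exact: proper_cone_adjoin.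
exists (RealSpec (total_proper_cone_ordering _ Xproper Mtot)) => b Pb.
by right.
Qed.

End FieldCones.

(** * The real spectrum *)

Section RealSpectrum.
Variable B : comNzRingType.

Lemma ordering_total (alpha : real_spec B) (a : B) :
  ordering_cone alpha a \/ ordering_cone alpha (- a).
Proof.
case: alpha => P [[Pcone _] Pprime] /=; apply: Pprime.
by rewrite -expr2; exact: cone_sqr.
Qed.

Lemma basic_open1P (f : B) (alpha : real_spec B) :
  basic_open [:: f] alpha <-> ~ ordering_cone alpha (- f).
Proof.
split=> [/(_ f)|aNf g]; rewrite inE.
  by move=> /(_ (eqxx f)) [af asupp] aNf; apply: asupp.
move=> /eqP ->; have [af|//] := ordering_total alpha f.
by split=> // -[].
Qed.

Lemma basic_open_open (fs : seq B) : open (basic_open fs).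
Proof.
exists [set basic_open fs]; last by rewrite bigcup_set1.
by move=> _ ->; apply: filter.finI_from1; exists fs.
Qed.

End RealSpectrum.

Theorem theorem4p6 (A : idomainType) (rat_in_A : {rmorphism rat -> A})
    (K_real : formally_real {fraction A}) (alpha : real_spec A) :
  [<-> precentral_spec A alpha;
       forall f : A, basic_open [:: f] alpha ->
         is_proper_cone (sumsq_adjoin f);
       forall f : A, basic_open [:: f] alpha ->
         is_proper_cone (trace_on (sumsq_adjoin f)) /\
         is_central_cone (trace_on (sumsq_adjoin f));
       forall f : A, basic_open [:: f] alpha ->
         basic_open [:: f] `&` central_spec A !=set0].
Proof.
have sosK := sums_of_squares_cone {fraction A}.
tfae.
- move=> [_ sos_alpha] f /basic_open1P aNf.
  apply: proper_cone_adjoin => // sosNf.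
  by apply/aNf/sos_alpha; rewrite /trace_on /= rmorphN.
- move=> proper f /proper [Kcone KN1].
  have Acone : is_cone (trace_on (sumsq_adjoin f)).
    split=> [a b|a b|b]; rewrite /trace_on /= ?rmorphD ?rmorphM ?rmorphXn /=.
    + exact: coneD.
    + exact: coneM.
    + exact: cone_sqr.
  split; split=> //; first by rewrite /trace_on /= rmorphN rmorph1.
  by move=> a; apply (sub_cone_adjoin {fraction A}).
- move=> proper f af; have [[_ AN1] _] := proper f af.
  have Kproper : is_proper_cone (sumsq_adjoin f).
    split; first exact: cone_adjoin_cone.
    by move: AN1; rewrite /trace_on /= rmorphN rmorph1.
  have [Q PQ] := proper_cone_sub_ordering _ _ Kproper.
  exists (restrict_ordering Q); split; last first.
    by apply: subset_closure; exists Q.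
  apply/basic_open1P; rewrite /= /trace_on /= rmorphN => QNf.
  have Qproper := ordering_proper (ordering_coneP Q).
  have /eqP := proper_cone_supp0 _ _ _ Qproper (PQ _ (mem_cone_adjoin _ _ _)) QNf.
  rewrite tofrac_eq0 => /eqP f0.
  move/basic_open1P: af; apply; rewrite f0 oppr0.
  have [[acone _] _] := ordering_coneP alpha.
  exact: cone0.
- move=> meets; have [[acone _] _] := ordering_coneP alpha.
  split=> // a sosa; apply: contrapT => aNa.
  have /meets [beta [betaS]] : basic_open [:: - a] alpha.
    by apply/basic_open1P; rewrite opprK.
  have nbhsS := open_nbhs_nbhs (conj (basic_open_open _ [:: - a]) betaS).
  move=> /(_ _ nbhsS) [_ [[Q _ <-] /basic_open1P]].
  rewrite opprK; apply; apply: sums_of_squares_sub sosa.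
  by have [[]] := ordering_coneP Q.
Qed.
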